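(* Let $s,t\geq 1$ be integers and let $p,q,l$ be three distinct primes with $p,q$ odd, $p\equiv 3 \pmod 4$, $\mathrm{ord}_{p^s}(l)=\phi(p^s)/2$, $\mathrm{ord}_{q^t}(l)=\phi(q^t)$ and $\gcd(\phi(p^s),\phi(q^t))=2$. Let $0\leq i<i'\leq s-1$ and $0\leq j\leq t-1$. Then in the ring $\mathbb{F}_l[x]/\langle x^{p^sq^t}-1\rangle$: (i) If $q$ is a quadratic residue modulo $p$, then \[\chi_{ij}\chi_{i'j}^*=\frac{\phi(p^{s-i'})}{2}(q-2)q^{t-j-1}\chi_{ij}+\frac{\phi(p^{s-i'})}{2}\phi(q^{t-j})\sum_{j<m\leq t}\chi_{im}.\] (ii) If $q$ is a quadratic nonresidue modulo $p$, then \[ \chi_{ij}\chi_{i'j}^*=\frac{\phi(p^{s-i'})}{2}(q-2)q^{t-j-1}\chi_{ij}+\frac{\phi(p^{s-i'})}{2}\phi(q^{t-j})\Big(\sum_{\substack{j<m\leq t\\2\nmid m-j}}\chi_{im}^*+\sum_{\substack{j<m\leq t\\2\mid m-j}}\chi_{im}\Big). \]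
   Context: Here $\phi$ is Euler's phi function (with $\phi(1)=1$) and $\mathrm{ord}_m(k)$ is the multiplicative order of $k$ modulo $m$. Put $n=p^sq^t$. Fix an integer $g$ that is a primitive root both modulo $p^s$ and modulo $q^t$. For an integer $\gamma$, $C_\gamma=\{\gamma l^r \bmod n: r\geq 0\}\subseteq \mathbb{Z}_n$ is the $l$-cyclotomic coset modulo $n$ containing $\gamma$. For $0\leq i\leq s$, $0\leq j\leq t$ set $C_{ij}=C_{p^iq^j}$ and $C_{ij}^*=C_{p^iq^jg}$. Define elements of $\mathbb{F}_l[x]/\langle x^{n}-1\rangle$ by $\chi_{ij}=\sum_{\alpha\in C_{ij}}x^\alpha$ and $\chi_{ij}^*=\sum_{\alpha\in C_{ij}^*}x^\alpha$. Integer coefficients are read in $\mathbb{F}_l$, and empty sums are $0$. *)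

(* Defs.v *)
From HB Require Import structures.
From mathcomp Require Import all_boot all_order all_algebra all_fingroup.
Set Implicit Arguments.
Unset Strict Implicit.
Unset Printing Implicit Defensive.
Import GRing.Theory.
Local Open Scope ring_scope.

(* Multiplicative order of k modulo m, with value 0 when k is not invertible
   modulo m.  Meaningful for m > 1 only, since 'Z_0 and 'Z_1 denote 'Z_2. *)
Definition ordm (m : nat) (k : int) : nat :=
  if insub (k%:~R : 'Z_m) is Some u then #[(u : {unit 'Z_m})]%g else 0%N.

Definition primitive_root_mod (m : nat) (g : int) : Prop :=
  ordm m g = totient m.

Definition quad_residue (p a : nat) : Prop :=
  coprime a p /\ exists x : nat, x ^ 2 = a %[mod p].

Definition quad_nonresidue (p a : nat) : Prop :=
  coprime a p /\ ~ (exists x : nat, x ^ 2 = a %[mod p]).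

(* The iterates of gamma under multiplication by l; see cyclo_cosetP. *)
Definition cyclo_coset (n l : nat) (gamma : int) : {set 'Z_n} :=
  [set a | fconnect (fun z : 'Z_n => z * l%:R) gamma%:~R a].

Lemma cyclo_cosetP (n l : nat) (gamma : int) (a : 'Z_n) :
  reflect (exists r : nat, a = (gamma * l%:Z ^+ r)%:~R)
          (a \in cyclo_coset n l gamma).
Proof.
have iterE r : iter r (fun z : 'Z_n => z * l%:R) gamma%:~R
               = (gamma * l%:Z ^+ r)%:~R.
  elim: r => [|r IHr] /=; first by rewrite expr0 mulr1.
  by rewrite IHr exprSr mulrA [in RHS]intrM -pmulrn.
rewrite inE; apply: (iffP idP) => [/iter_findex <-|[r ->]].
  by exists (findex (fun z : 'Z_n => z * l%:R) gamma%:~R a); rewrite iterE.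
by rewrite -iterE fconnect_iter.
Qed.

(* F_l[x] / <x^n - 1>, in which 'qX is the class of x. *)
Definition cyclic_ring (l n : nat) := {poly %/ ('X^n - 1 : {poly 'F_l})}.

(* {poly %/ h} is the quotient by mk_monic h, which is h here. *)
Lemma mk_monic_Xn_sub_1 (l n : nat) :
  (0 < n)%N -> mk_monic ('X^n - 1 : {poly 'F_l}) = 'X^n - 1.
Proof.
by move=> n0; rewrite /mk_monic size_XnsubC // ltnS n0 monicXnsubC.
Qed.

Definition coset_sum (l n : nat) (gamma : int) : cyclic_ring l n :=
  \sum_(a in cyclo_coset n l gamma) 'qX ^+ a.

Definition chi (p s q t l i j : nat) : cyclic_ring l (p ^ s * q ^ t) :=
  coset_sum l (p ^ s * q ^ t) (p ^ i * q ^ j)%N.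

Definition chi_star (p s q t l : nat) (g : int) (i j : nat) :
    cyclic_ring l (p ^ s * q ^ t) :=
  coset_sum l (p ^ s * q ^ t) ((p ^ i * q ^ j)%N%:Z * g).

(* Main.v *)
Require Import Defs.
From mathcomp Require Import all_boot all_order all_algebra all_fingroup.
From mathcomp Require Import cyclic zify ring.
Local Open Scope ring_scope.
Import GRing.Theory.

(* The orders of l modulo p^s and q^t are coprime, so under the Chinese remainder
   isomorphism a coset of <l> modulo n is the full product of its two projections.
   Writing x = zeta * eta with zeta^(p^s) = eta^(q^t) = 1, every coset sum is thus a sum
   of powers of zeta times a sum of powers of eta.
   Modulo p^s, <l> is the group H of squares and it contains 1 + pZ; as i < i', adding
   an element of p^i' q^j g H permutes p^i q^j H, which gives the factor
   |p^i' H| = phi(p^(s-i'))/2. Modulo q^t, <l> consists of all the units U, and q^j U is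
   a difference of two ideals, so that the square of its exponential sum is computed
   from S_j S_k = q^(t-k) S_j (j <= k), where S_j is the sum over the ideal of q^j.
   Finally p^i q^m H is p^i q^j H or p^i q^j g H according to whether q^(m-j) is a
   square. *)

(** * Exponential sums and the Chinese remainder splitting *)

Definition exp_sum (R : comNzRingType) (m : nat) (z : R) (X : {set 'Z_m}) : R :=
  \sum_(x in X) z ^+ x.

(** Exponents are canonical representatives below [m]; [z ^+ m = 1] makes [x |-> z ^+ x] a
    character. *)
Lemma exp_ZpD (R : comNzRingType) (m : nat) (z : R) (x y : 'Z_m) :
  (1 < m)%N -> z ^+ m = 1 -> z ^+ (x + y)%R = z ^+ x * z ^+ y.
Proof.
move=> m1 zm; rewrite -exprD -[RHS](expr_mod _ zm); congr (z ^+ _) => /=.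
by congr (_ %% _)%N; rewrite Zp_cast.
Qed.

(** Translation by [y] in [Y] maps the finite set [X] injectively into itself, hence permutes it, so
    multiplying by [z ^+ y] leaves the sum over [X] unchanged. *)
Lemma exp_sum_absorb (R : comNzRingType) (m : nat) (z : R) (X Y : {set 'Z_m}) :
  (1 < m)%N -> z ^+ m = 1 ->
  (forall x y, x \in X -> y \in Y -> x + y \in X) ->
  exp_sum R m z X * exp_sum R m z Y = exp_sum R m z X *+ #|Y|.
Proof.
move=> m1 zm XY; rewrite /exp_sum mulr_sumr -sumr_const.
apply: eq_bigr => y yY.
have injy : injective (fun x : 'Z_m => x + y) by apply: addIr.
have defX : [set x + y | x in X] = X.
  apply/eqP; rewrite eqEcard card_imset // leqnn andbT.
  by apply/subsetP => _ /imsetP[x xX ->]; apply: XY.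
rewrite -{2}defX big_imset /=; last by move=> ? ? _ _; apply: injy.
by rewrite mulr_suml; apply: eq_bigr => x _; rewrite (@exp_ZpD _ m).
Qed.

Lemma Zp_intr_nat (m : nat) (k : int) : (0 < m)%N ->
  exists r : nat, forall d, (1 < d)%N -> (d %| m)%N -> k%:~R = r%:R :> 'Z_d.
Proof.
move=> m0; have mN0 : (m%:Z != 0) by rewrite eqz_nat -lt0n.
have := modz_ge0 k mN0; case E: (k %% m)%Z => [r|//] _.
exists r => d d1 /dvdnP[c mE]; rewrite (divz_eq k m) E mE PoszM.
by rewrite rmorphD !rmorphM /= -!pmulrn pchar_Zp // !mulr0 add0r.
Qed.

Lemma Zp_red_int (m d : nat) (k : int) : (1 < d)%N -> (1 < m)%N -> (d %| m)%N ->
  ((k%:~R : 'Z_m) : nat)%:R = k%:~R :> 'Z_d.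
Proof.
move=> d1 m1 dm; have [r rE] := Zp_intr_nat m k (ltnW m1).
by rewrite !rE //; apply: val_inj => /=; rewrite !val_Zp_nat // modn_dvdm.
Qed.

(** The exponents are the Chinese remainder idempotents: one is 1 modulo [M] and 0 modulo [N], the
    other the reverse, and they add up to 1 modulo [M * N]. *)
Lemma chinese_root_split (R : comNzRingType) (M N : nat) (z : R) :
  coprime M N -> z ^+ (M * N) = 1 ->
  exists zeta eta : R, [/\ zeta ^+ M = 1, eta ^+ N = 1 & z = zeta * eta].
Proof.
move=> co zMN; exists (z ^+ chinese M N 1 0), (z ^+ chinese M N 0 1).
split; first 2 last.
- rewrite -exprD -(expr_mod _ zMN) -[LHS]expr1 -[in LHS](expr_mod 1 zMN).
  congr (_ ^+ _); apply/eqP; rewrite chinese_remainder //.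
  rewrite -modnDm !chinese_modl // modnDm addn0 eqxx /=.
  by rewrite -modnDm !chinese_modr // modnDm add0n eqxx.
- have /eqP := chinese_modr co 1 0; rewrite mod0n -/(dvdn _ _) => /dvdnP[k ->].
  by rewrite -exprM -mulnA [(N * M)%N]mulnC mulnC exprM zMN expr1n.
- have /eqP := chinese_modl co 0 1; rewrite mod0n -/(dvdn _ _) => /dvdnP[k ->].
  by rewrite -exprM -mulnA mulnC exprM zMN expr1n.
Qed.

(** As the periods [a] and [b] are coprime, the powers of [l] modulo [M] and modulo [N] can be
    chosen independently, so the coset maps onto the full product of its projections. *)
Lemma exp_sum_cyclo_coset_split (R : comNzRingType) (M N l a b : nat)
    (zeta eta : R) (gamma : int) :
  (1 < M)%N -> (1 < N)%N -> coprime M N -> coprime a b ->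
  l%:R ^+ a = 1 :> 'Z_M -> l%:R ^+ b = 1 :> 'Z_N ->
  zeta ^+ M = 1 -> eta ^+ N = 1 ->
  exp_sum R (M * N) (zeta * eta) (cyclo_coset (M * N) l gamma) =
  exp_sum R M zeta (cyclo_coset M l gamma) * exp_sum R N eta (cyclo_coset N l gamma).
Proof.
move=> M1 N1 coMN coab la lb zM eN.
have MN1 : (1 < M * N)%N.
  by apply: (leq_trans M1); rewrite leq_pmulr // ltnW.
rewrite /exp_sum mulr_suml.
under [RHS]eq_bigr do rewrite mulr_sumr.
rewrite pair_big_dep /=.
pose f (x : 'Z_(M * N)) : 'Z_M * 'Z_N := ((x : nat)%:R, (x : nat)%:R).
have fint k : f (k%:~R) = (k%:~R, k%:~R).
  by rewrite /f; congr (_, _); apply: Zp_red_int => //; [apply: dvdn_mulr|apply: dvdn_mull].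
have finj : injective f.
  move=> x y [ex ey]; move: (congr1 (@nat_of_ord _) ex) (congr1 (@nat_of_ord _) ey).
  rewrite !val_Zp_nat // => exM exN.
  have /eqP : x = y %[mod M * N].
    by apply/eqP; rewrite chinese_remainder // exM exN !eqxx.
  have xlt (u : 'Z_(M * N)) : (u < M * N)%N by rewrite -[X in (_ < X)%N](@Zp_cast (M * N)).
  by rewrite !modn_small // => /eqP/val_inj.
pose X := cyclo_coset M l gamma; pose Y := cyclo_coset N l gamma.
have imf : [set f x | x in cyclo_coset (M * N) l gamma] = setX X Y.
  apply/setP => -[x y]; rewrite in_setX; apply/imsetP/andP.
    move=> [_ /cyclo_cosetP[r ->]]; rewrite fint => -[-> ->].
    by split; apply/cyclo_cosetP; exists r.
  move=> [/cyclo_cosetP[r ->] /cyclo_cosetP[r' ->]].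
  (* One exponent, congruent to [r] modulo [a] and to [r'] modulo [b], realises both residues. *)
  pose k := chinese a b r r'.
  exists ((gamma * l%:Z ^+ k)%:~R); first by apply/cyclo_cosetP; exists k.
  rewrite fint !rmorphM !rmorphXn /= -!pmulrn; congr (_ * _, _ * _).
    by rewrite -(expr_mod k la) chinese_modl // expr_mod.
  by rewrite -(expr_mod k lb) chinese_modr // expr_mod.
rewrite (eq_bigl (fun u => u \in setX X Y)); last first.
  by move=> [x y]; rewrite in_setX.
rewrite -imf big_imset /=; last by move=> ? ? _ _; apply: finj.
apply: eq_bigr => x _; rewrite exprMn !val_Zp_nat //.
by rewrite (expr_mod _ zM) (expr_mod _ eN).
Qed.

(** * Orbits under groups of units *)

Lemma ordm_exp (m d : nat) (k : int) :
  ordm m k = d -> (0 < d)%N ->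
  exists u : {unit 'Z_m}, val u = k%:~R /\ #[u]%g = d.
Proof.
rewrite /ordm; case: insubP => [u _ uE <- _|_ <- //].
by exists u.
Qed.

(** [c] may be a zero divisor, so an orbit can be smaller than [H]. *)
Definition unit_orbit (m : nat) (H : {set {unit 'Z_m}}) (c : 'Z_m) : {set 'Z_m} :=
  [set c * val h | h in H].

Lemma cyclo_coset_orbit (m l : nat) (L : {unit 'Z_m}) (gamma : int) :
  val L = l%:R -> cyclo_coset m l gamma = unit_orbit m <[L]>%g gamma%:~R.
Proof.
move=> LE; apply/setP => x; apply/cyclo_cosetP/imsetP.
  move=> [r ->]; exists (L ^+ r)%g; first exact: mem_cycle.
  by rewrite FinRing.val_unitX LE rmorphM rmorphXn.
move=> [_ /cycleP[r ->] ->]; exists r.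
by rewrite FinRing.val_unitX LE rmorphM rmorphXn.
Qed.

Lemma unit_orbitM (m : nat) (H : {group {unit 'Z_m}}) (c : 'Z_m) (h : {unit 'Z_m}) :
  h \in H -> unit_orbit m H (c * val h) = unit_orbit m H c.
Proof.
move=> hH; apply/setP => x; apply/imsetP/imsetP => -[k kH ->].
  by exists (h * k)%g; rewrite ?groupM // FinRing.val_unitM mulrA.
exists (h^-1 * k)%g; rewrite ?groupM ?groupV //.
by rewrite FinRing.val_unitM FinRing.val_unitV -mulrA mulVKr // (valP h).
Qed.

Lemma card_unit_orbitM (m : nat) (H : {set {unit 'Z_m}}) (c : 'Z_m) (u : {unit 'Z_m}) :
  #|unit_orbit m H (c * val u)| = #|unit_orbit m H c|.
Proof.
rewrite -(card_imset (unit_orbit m H c) (mulIr (valP u))); congr #|pred_of_set _|.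
rewrite /unit_orbit -imset_comp; apply: eq_imset => h /=.
by rewrite -!mulrA [val u * _]mulrC.
Qed.

(** * Ideals and unit orbits modulo a prime power *)

Definition multiples (m : nat) (c : 'Z_m) : {set 'Z_m} := [set c * y | y : 'Z_m].

Lemma multiplesP (m : nat) (c x : 'Z_m) :
  reflect (exists y, x = c * y) (x \in multiples m c).
Proof. by apply: (iffP imsetP) => [[y _ ->]|[y ->]]; exists y. Qed.

Section PrimePower.

Variables (p s : nat).
Hypotheses (pr : prime p) (s0 : (0 < s)%N).
Local Notation m := (p ^ s)%N.

Lemma prime_power_gt1 : (1 < m)%N.
Proof. by rewrite -(exp1n s) ltn_exp2r // prime_gt1. Qed.
Let m1 := prime_power_gt1.

Lemma Zp_prime_exp0 : p%:R ^+ s = 0 :> 'Z_m.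
Proof. by rewrite -natrX pchar_Zp. Qed.

Lemma Zp_prime_exp_neq0 (j : nat) : (j < s)%N -> p%:R ^+ j != 0 :> 'Z_m.
Proof.
move=> js; rewrite -natrX; apply/eqP => /(congr1 (@nat_of_ord _)).
rewrite val_Zp_nat // modn_small ?ltn_exp2l ?prime_gt1 //.
by move=> /eqP; rewrite expn_eq0 => /andP[/eqP p0 _]; move: (prime_gt0 pr); rewrite p0.
Qed.

(** ['Z_m] is a local ring with maximal ideal generated by [p]. *)
Lemma Zp_prime_nonunit (y : 'Z_m) :
  y \isn't a GRing.unit -> exists z, y = p%:R * z.
Proof.
rewrite -[y]natr_Zp unitZpE // coprime_pexpl // prime_coprime // negbK.
by move=> /dvdnP[k ->]; exists k%:R; rewrite -natrM mulnC.
Qed.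

Lemma Zp_prime_mul_nonunit (z : 'Z_m) : p%:R * z \isn't a GRing.unit.
Proof.
apply/negP => /(unitrX s); rewrite exprMn Zp_prime_exp0 mul0r.
by rewrite unitr0.
Qed.

(** If [p^j u] lay in the smaller ideal, then [p^j (u - p z) = 0]; here [u - p z] is a unit, as
    otherwise [p] would divide [u], so [p^j = 0], which [j < s] excludes. *)
Lemma unit_orbit_setT (j : nat) : (j < s)%N ->
  unit_orbit m setT (p%:R ^+ j) =
  multiples m (p%:R ^+ j) :\: multiples m (p%:R ^+ j.+1).
Proof.
move=> js; apply/setP => x; rewrite inE; apply/imsetP/andP.
  move=> [u _ ->]; split; last by apply/multiplesP; exists (val u).
  apply/multiplesP => -[z /eqP]; rewrite exprSr -mulrA -subr_eq0 -mulrBr.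
  case: (boolP (val u - p%:R * z \is a GRing.unit)) => [uz|].
    by rewrite (mulIr_eq0 _ (mulIr uz)) (negPf (Zp_prime_exp_neq0 _ js)).
  move=> /Zp_prime_nonunit[w /eqP]; rewrite subr_eq -mulrDr => /eqP uE.
  by have := valP u; rewrite uE (negPf (Zp_prime_mul_nonunit _)).
move=> [/multiplesP xN /multiplesP[y xE]].
case: (boolP (y \is a GRing.unit)) => [uy|/Zp_prime_nonunit[z yE]].
  by exists (FinRing.unit _ uy).
by case: xN; exists z; rewrite exprSr -mulrA -yE.
Qed.

Lemma card_multiples (j : nat) : (j <= s)%N ->
  #|multiples m (p%:R ^+ j)| = (p ^ (s - j))%N.
Proof.
move=> js; have p0 := prime_gt0 pr.
have mE : m = (p ^ j * p ^ (s - j))%N by rewrite -expnD subnKC.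
pose f (k : 'I_(p ^ (s - j))) : 'Z_m := (p ^ j * k)%:R.
have finj : injective f.
  move=> k k' /(congr1 (@nat_of_ord _)); rewrite !val_Zp_nat // mE.
  rewrite -!muln_modr !modn_small // => /eqP.
  by rewrite eqn_pmul2l ?expn_gt0 ?p0 // => /eqP/val_inj.
rewrite -[RHS]card_ord -cardsT -(card_imset _ finj); congr #|pred_of_set _|.
apply/setP => x; apply/multiplesP/imsetP => [[y ->]|[k _ ->]].
  have ylt : (y %% p ^ (s - j) < p ^ (s - j))%N by rewrite ltn_mod expn_gt0 p0.
  exists (Ordinal ylt) => //; rewrite /f /= -[in LHS](natr_Zp y) -natrX -natrM.
  apply: ord_inj; rewrite !val_Zp_nat //; move: (nat_of_ord y) => {ylt} k.
  by rewrite mE -!muln_modr modn_mod.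
by exists k%:R; rewrite /f natrM natrX.
Qed.

Lemma exp_sum_multiplesM (R : comNzRingType) (z : R) (j k : nat) :
  z ^+ m = 1 -> (j <= k <= s)%N ->
  exp_sum R m z (multiples m (p%:R ^+ j)) * exp_sum R m z (multiples m (p%:R ^+ k)) =
  exp_sum R m z (multiples m (p%:R ^+ j)) *+ (p ^ (s - k)).
Proof.
move=> zm /andP[jk ks]; rewrite -card_multiples //.
apply: exp_sum_absorb => // x y /multiplesP[a ->] /multiplesP[b ->].
by apply/multiplesP; exists (a + p%:R ^+ (k - j) * b); rewrite mulrDr mulrA -exprD subnKC.
Qed.

Lemma exp_sum_units (R : comNzRingType) (z : R) (j : nat) : (j < s)%N ->
  exp_sum R m z (unit_orbit m setT (p%:R ^+ j)) =
  exp_sum R m z (multiples m (p%:R ^+ j)) - exp_sum R m z (multiples m (p%:R ^+ j.+1)).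
Proof.
move=> js; rewrite unit_orbit_setT //; apply/eqP; rewrite eq_sym subr_eq; apply/eqP.
rewrite /exp_sum [LHS](big_setID (multiples m (p%:R ^+ j.+1))) /= addrC.
congr (_ + _); apply: eq_bigl => x; rewrite inE andb_idl //.
by move=> /multiplesP[y ->]; apply/multiplesP; exists (p%:R * y); rewrite exprSr mulrA.
Qed.

(** At the exponent [s] both sets are [{0}]; the difference of ideals used for [j < s] would be
    empty here. *)
Lemma exp_sum_units_top (R : comNzRingType) (z : R) :
  exp_sum R m z (unit_orbit m setT (p%:R ^+ s)) =
  exp_sum R m z (multiples m (p%:R ^+ s)).
Proof.
congr exp_sum; apply/setP => x; rewrite Zp_prime_exp0.
apply/imsetP/multiplesP => [[u _ ->]|[y ->]]; first by exists (val u).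
by exists 1%g => //; rewrite !mul0r.
Qed.

Lemma sum_exp_sum_units (R : comNzRingType) (z : R) (j : nat) : (j < s)%N ->
  \sum_(j.+1 <= k < s.+1) exp_sum R m z (unit_orbit m setT (p%:R ^+ k)) =
  exp_sum R m z (multiples m (p%:R ^+ j.+1)).
Proof.
move=> js; rewrite big_nat_recr //= exp_sum_units_top.
under eq_big_nat => k /andP[_ ks] do rewrite exp_sum_units // -opprB.
by rewrite sumrN telescope_sumr // opprB subrK.
Qed.

(** Let [S], [S'] be the sums over the ideals of [p^j], [p^(j+1)] and [e = p^(s-j-1)]. Then
    [S^2 = p e S], [S S' = e S] and [S'^2 = e S'], so [(S - S')^2 = (p-2) e (S - S') + (p-1) e
    S']. *)
Lemma exp_sum_units_sqr (R : comNzRingType) (z : R) (j : nat) :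
  z ^+ m = 1 -> (j < s)%N ->
  exp_sum R m z (unit_orbit m setT (p%:R ^+ j)) ^+ 2 =
  exp_sum R m z (unit_orbit m setT (p%:R ^+ j)) *+ ((p - 2) * p ^ (s - j - 1))
  + (\sum_(j.+1 <= k < s.+1) exp_sum R m z (unit_orbit m setT (p%:R ^+ k)))
      *+ totient (p ^ (s - j)).
Proof.
move=> zm js; have p1 := prime_gt1 pr; rewrite sum_exp_sum_units // exp_sum_units //.
have jjs : (j <= j <= s)%N by rewrite leqnn ltnW.
have jjs' : (j <= j.+1 <= s)%N by rewrite leqnSn.
have jjs'' : (j.+1 <= j.+1 <= s)%N by rewrite leqnn.
rewrite sqrrB !expr2 !exp_sum_multiplesM //.
have -> : (s - j = (s - j.+1).+1)%N by lia.
rewrite totient_pfactor // subn1 /=.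
have [c pE] : exists c, p = c.+2 by exists (p - 2)%N; lia.
have -> : (p - 2 = c)%N by lia.
have -> : p.-1 = c.+1 by rewrite pE.
rewrite expnS; have : p%:R = c%:R + 2 :> R by rewrite pE -addn2 natrD.
move: (exp_sum _ _ _ _) (exp_sum _ _ _ _) => S' S; move: (p ^ _)%N => e pR.
rewrite -!(mulr_natr S) -!(mulr_natr S') -(mulr_natr (S - S')) !natrM -natr1 pR; ring.
Qed.

(** Raising [1 + p^(k+1) w] to the power [p] multiplies the linear term by [p], and the remainder
    carries [p^(2k+2)], a multiple of [p^(k+2)]. *)
Lemma one_plus_prime_exp (z : 'Z_m) (k : nat) :
  exists w, (1 + p%:R * z) ^+ (p ^ k) = 1 + p%:R ^+ k.+1 * w.
Proof.
elim: k => [|k [w IHk]]; first by exists z; rewrite expn0 !expr1.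
have binom (y : 'Z_m) n : exists v, (1 + y) ^+ n = 1 + n%:R * y + y ^+ 2 * v.
  elim: n => [|n [v IHn]]; first by exists 0; rewrite mul0r mulr0 !addr0.
  exists (n%:R + v + y * v); rewrite exprS IHn -natr1; ring.
rewrite expnSr exprM IHk; have [v ->] := binom (p%:R ^+ k.+1 * w) p.
by exists (w + p%:R ^+ k * w ^+ 2 * v); rewrite ![p%:R ^+ _.+1]exprS; ring.
Qed.

(** * The subgroup of squares modulo an odd prime power *)

Section IndexTwo.

Variables (G : {unit 'Z_m}) (H : {group {unit 'Z_m}}).
Hypotheses (p_odd : odd p) (G_order : #[G]%g = totient m).
Hypothesis H_card : #|H| = (totient m %/ 2)%N.

Lemma even_totient_prime_power : (2 %| totient m)%N.
Proof.
by rewrite totient_pfactor // dvdn_mulr // -subn1 dvdn2 oddB ?prime_gt0 // p_odd.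
Qed.

Let genG (u : {unit 'Z_m}) : exists k, u = (G ^+ k)%g.
Proof.
apply/cycleP; suff -> : <[G]>%g = [set: {unit 'Z_m}] by rewrite inE.
apply/eqP; rewrite eqEcard subsetT -orderE G_order -card_units_Zp ?expn_gt0 ?prime_gt0 ?leqnn //.
Qed.

(** A cyclic group has only one subgroup of each order, and [G ^+ 2] has order half that of [G]. *)
Let HE : (H : {set {unit 'Z_m}}) = <[G ^+ 2]>%g.
Proof.
apply/eqP; rewrite (@eq_subG_cyclic _ <[G]>) ?cycle_cyclic //.
- by rewrite -orderE orderXdiv G_order ?even_totient_prime_power // H_card.
- by apply/subsetP => u _; have [k ->] := genG u; apply: mem_cycle.
by rewrite cycle_subG mem_cycle.
Qed.

Lemma index2_sqr (u : {unit 'Z_m}) : (u ^+ 2)%g \in H.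
Proof.
by have [k ->] := genG u; rewrite HE -expgM mulnC expgM mem_cycle.
Qed.

Lemma index2_sqrt (u : {unit 'Z_m}) : u \in H -> exists v, u = (v ^+ 2)%g.
Proof.
by rewrite HE => /cycleP[k ->]; exists (G ^+ k)%g; rewrite -!expgM mulnC.
Qed.

(** An element outside [H] is an odd power of [G]; one more factor makes the exponent even. *)
Lemma index2_mul_generator (u : {unit 'Z_m}) : u \notin H -> (u * G)%g \in H.
Proof.
have [k ->] := genG u; rewrite -expgSr -[in X in X -> _](odd_double_half k) => uH.
have k_odd : odd k.
  by apply: contraR uH => /negPf ->; rewrite -mul2n expgM HE mem_cycle.
rewrite -(odd_double_half k) k_odd -addSn -mul2n (expgD _ 2) expgM HE.
by rewrite groupM ?mem_cycle ?cycle_id.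
Qed.

Lemma index2_generator : G \notin H.
Proof.
apply/negP => GH; have : (#[G]%g <= #|H|)%N by rewrite subset_leq_card ?cycle_subG.
rewrite G_order H_card leqNgt ltn_Pdiv // totient_gt0 expn_gt0 prime_gt0 //.
Qed.

(* [1 + p z] has order a power of the odd number [p], so it is a square. *)
Lemma index2_one_plus (u : {unit 'Z_m}) (z : 'Z_m) :
  val u = 1 + p%:R * z -> u \in H.
Proof.
move=> uE; have [w] := one_plus_prime_exp z s.-1.
rewrite prednK // Zp_prime_exp0 mul0r addr0 -uE -FinRing.val_unitX => u1.
have {}u1 : (u ^+ (p ^ s.-1) = 1)%g by apply: val_inj.
have := index2_sqr (u ^+ (p ^ s.-1)./2.+1).
rewrite -expgM muln2 doubleS.
have -> : ((p ^ s.-1)./2.*2.+2 = (p ^ s.-1).+1)%N.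
  by rewrite -[in RHS](odd_double_half (p ^ s.-1)) oddX p_odd orbT.
by rewrite expgS u1 mulg1.
Qed.

(** The quotient [v / u] is [1 + p (z / u)], an element of [H]: membership in [H] depends only on
    the residue modulo [p]. *)
Lemma index2_congr (u v : {unit 'Z_m}) (z : 'Z_m) :
  u \in H -> val v = val u + p%:R * z -> v \in H.
Proof.
move=> uH vE; rewrite -(groupMl _ (groupVr uH)).
apply: (@index2_one_plus _ (z / val u)).
rewrite FinRing.val_unitM FinRing.val_unitV vE mulrDr mulVr ?(valP u) //.
by rewrite mulrCA [_^-1 * _]mulrC.
Qed.

(** [c u + c p d v = c (u + p d v)], and the second factor is a unit congruent to [u] modulo [p], so
    it stays in [H]. *)
Lemma unit_orbit_absorb (c d x y : 'Z_m) :
  x \in unit_orbit m H c -> y \in unit_orbit m H (c * (p%:R * d)) ->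
  x + y \in unit_orbit m H c.
Proof.
move=> /imsetP[u uH ->] /imsetP[v vH ->].
have w_unit : val u + p%:R * (d * val v) \is a GRing.unit.
  apply: contraT => /Zp_prime_nonunit[z /eqP]; rewrite eq_sym -subr_eq -mulrBr => /eqP uE.
  by have := valP u; rewrite -uE (negPf (Zp_prime_mul_nonunit _)).
apply/imsetP; exists (FinRing.unit _ w_unit); first exact: (index2_congr u _ (d * val v)).
by rewrite /= mulrDr !mulrA.
Qed.

(** The orbit of [p^k] under all units splits into those of [p^k] and [p^k G] under [H], of equal
    size. They are disjoint: [p^k u = p^k G v] with [k < s] makes [u] and [G v] agree modulo [p],
    which would put [G] in [H]. *)
Lemma card_unit_orbit (k : nat) : (k < s)%N ->
  #|unit_orbit m H (p%:R ^+ k)| = (totient (p ^ (s - k)) %/ 2)%N.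
Proof.
move=> ks; have splitT : unit_orbit m setT (p%:R ^+ k) =
    unit_orbit m H (p%:R ^+ k) :|: unit_orbit m H (p%:R ^+ k * val G).
  apply/setP => x; rewrite inE; apply/imsetP/orP.
    move=> [u _ ->]; case: (boolP (u \in H)) => [uH|uH].
      by left; apply/imsetP; exists u.
    right; apply/imsetP; exists (G^-1 * u)%g.
      have := index2_mul_generator u^-1; rewrite groupV => /(_ uH).
      by rewrite -groupV invMg invgK.
    by rewrite -mulrA -FinRing.val_unitM mulKVg.
  move=> [|] /imsetP[u uH ->]; first by exists u.
  by exists (G * u)%g => //; rewrite FinRing.val_unitM mulrA.
have disj : [disjoint unit_orbit m H (p%:R ^+ k) & unit_orbit m H (p%:R ^+ k * val G)].
  apply/pred0P => x /=; apply/negP => /andP[/imsetP[u uH ->] /imsetP[v vH] /eqP].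
  rewrite -mulrA -subr_eq0 -mulrBr.
  case: (boolP (val u - val G * val v \is a GRing.unit)) => [wu|].
    by rewrite (mulIr_eq0 _ (mulIr wu)) (negPf (Zp_prime_exp_neq0 _ ks)).
  move=> /Zp_prime_nonunit[z /eqP]; rewrite subr_eq -FinRing.val_unitM => /eqP uE _.
  have : (G * v)%g \in H.
    apply: (@index2_congr u _ (- z)) => //; rewrite uE mulrN; ring.
  by rewrite groupMr // (negPf index2_generator).
have : #|unit_orbit m setT (p%:R ^+ k)| = (totient (p ^ (s - k)))%N.
  rewrite unit_orbit_setT // cardsD (setIidPr _); last first.
    apply/subsetP => _ /multiplesP[y ->].
    by apply/multiplesP; exists (p%:R * y); rewrite exprSr mulrA.
  rewrite !card_multiples //; last exact: ltnW.
  have -> : (s - k = (s - k.+1).+1)%N by lia.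
  by rewrite totient_pfactor // expnS -[X in (_ - X)%N]mul1n -mulnBl subn1.
rewrite splitT cardsU disjoint_setI0 // cards0 subn0 card_unit_orbitM addnn -muln2 => <-.
by rewrite mulnK.
Qed.

End IndexTwo.

End PrimePower.

(** * The quotient ring, quadratic residues and orders *)

Lemma qX_exp_eq1 (l n : nat) : (0 < n)%N -> 'qX ^+ n = 1 :> cyclic_ring l n.
Proof.
move=> n0; rewrite /qpolyX -rmorphXn /=; apply/eqP; rewrite -subr_eq0.
rewrite -(in_qpoly1 ('X^n - 1)) -rmorphB /=; apply/eqP/val_inj => /=.
by rewrite mk_monic_Xn_sub_1 // Pdiv.RingMonic.rmodpp // monicXnsubC.
Qed.

Lemma coset_sum_exp_sum (l n : nat) (gamma : int) :
  coset_sum l n gamma = exp_sum (cyclic_ring l n) n 'qX (cyclo_coset n l gamma).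
Proof. by []. Qed.

(** [q] agrees modulo [p] with the square of a unit, and agreement modulo [p] decides membership in
    the subgroup of squares. *)
Lemma quad_residue_in_index2 (p s : nat) (G L Q : {unit 'Z_(p ^ s)}) (q : nat) :
  prime p -> (0 < s)%N -> odd p ->
  #[G]%g = totient (p ^ s) -> #[L]%g = (totient (p ^ s) %/ 2)%N ->
  val Q = q%:R -> quad_residue p q -> Q \in <[L]>%g.
Proof.
move=> pr s0 p_odd oG oL QE [coqp [x xq]].
have x_unit : (x%:R : 'Z_(p ^ s)) \is a GRing.unit.
  rewrite unitZpE ?prime_power_gt1 // coprime_pexpl //.
  by rewrite -(coprime_pexpr _ _ (isT : (0 < 2)%N)) coprime_sym -coprime_modl xq coprime_modl.
pose X : {unit 'Z_(p ^ s)} := FinRing.unit _ x_unit.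
have X2 : (X ^+ 2)%g \in <[L]>%g by apply: (index2_sqr p s pr s0 G _ p_odd oG oL).
(* [q] and [x ^ 2] have the same remainder modulo [p], so they differ by [p] times the difference of
   their quotients. *)
apply: (index2_congr p s pr s0 G _ p_odd oG oL (X ^+ 2)%g _ ((q %/ p)%:R - (x ^ 2 %/ p)%:R)) => //.
rewrite FinRing.val_unitX /= QE -natrX [in LHS](divn_eq q p) -xq.
rewrite [in X in _ = X + _](divn_eq (x ^ 2) p) !natrD !natrM; ring.
Qed.

(** An element of the subgroup has a square root modulo [p^s], which reduces to one modulo [p]. *)
Lemma quad_nonresidue_notin_index2 (p s : nat) (G L Q : {unit 'Z_(p ^ s)}) (q : nat) :
  prime p -> (0 < s)%N -> odd p ->
  #[G]%g = totient (p ^ s) -> #[L]%g = (totient (p ^ s) %/ 2)%N ->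
  val Q = q%:R -> quad_nonresidue p q -> Q \notin <[L]>%g.
Proof.
move=> pr s0 p_odd oG oL QE [_ nres]; have m1 := prime_power_gt1 p s pr s0.
apply/negP => /(index2_sqrt p s pr s0 G _ p_odd oG oL)[v QvE]; case: nres.
exists (val v : nat); have := congr1 val QvE.
rewrite FinRing.val_unitX QE -(natr_Zp (val v)) -natrX => /(congr1 (@nat_of_ord _)).
rewrite !val_Zp_nat // => /(congr1 (modn^~ p)).
by rewrite !modn_dvdm // ?dvdn_exp // -[in X in _ -> X]modnXm modn_dvdm ?dvdn_exp // modnXm.
Qed.

(** Here [l] generates all units, so the unit part [u] of [gamma] is absorbed; this removes [p^i]
    and [g] modulo [q^t]. *)
Lemma cyclo_coset_primitive (m l : nat) (L u : {unit 'Z_m}) (gamma : int) (c : 'Z_m) :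
  (1 < m)%N -> val L = l%:R -> #[L]%g = totient m -> gamma%:~R = c * val u ->
  cyclo_coset m l gamma = unit_orbit m setT c.
Proof.
move=> m1 LE oL gE; rewrite (cyclo_coset_orbit _ _ L) // gE.
suff -> : <[L]>%g = [set: {unit 'Z_m}].
  by rewrite (unit_orbitM m [set: {unit 'Z_m}]%G) ?inE.
apply/eqP; rewrite eqEcard subsetT -orderE oL -card_units_Zp ?(ltnW m1) //.
by rewrite leqnn.
Qed.

(** For [p = 4 k + 3], the half [(2 k + 1) p^(s-1)] of the totient is odd, whereas its gcd with [b]
    divides 2. *)
Lemma coprime_half_totient (p s b : nat) : prime p -> (0 < s)%N -> p = 3 %[mod 4] ->
  gcdn (totient (p ^ s)) b = 2%N -> coprime (totient (p ^ s) %/ 2) b.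
Proof.
move=> pr s0 p34 gcd2; have p_odd : odd p.
  by rewrite -[odd p]negbK -dvdn2; move: p34; lia.
have := even_totient_prime_power p s pr s0 p_odd; set a := totient _ in gcd2 * => a2.
have half_odd : odd (a %/ 2).
  have [k pE] : exists k, p = (4 * k + 3)%N by exists (p %/ 4)%N; lia.
  have -> : a = (2 * ((2 * k).+1 * p ^ s.-1))%N.
    by rewrite /a totient_pfactor // mulnA; congr (_ * _)%N; lia.
  by rewrite mulKn // oddM oddX p_odd orbT /= mul2n odd_double.
have d2 : (gcdn (a %/ 2) b %| 2)%N.
  rewrite -[X in (_ %| X)%N]gcd2 dvdn_gcd dvdn_gcdr andbT.
  by apply: dvdn_trans (dvdn_gcdl _ _) _; rewrite -[X in (_ %| X)%N](divnK a2) dvdn_mulr.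
rewrite /coprime -(gcdn_idPl d2) -/(coprime _ 2) coprimen2.
exact: dvdn_odd (dvdn_gcdl _ _) half_odd.
Qed.

(** * The product formula *)

Theorem theorem4p15 (s t p q l : nat) (g : int) (i i' j : nat)
    (hs : (1 <= s)%N) (ht : (1 <= t)%N)
    (hp : prime p) (hq : prime q) (hl : prime l)
    (hpq : p <> q) (hpl : p <> l) (hql : q <> l)
    (hp_odd : odd p) (hq_odd : odd q) (hp34 : p = 3 %[mod 4])
    (hordp : ordm (p ^ s)%N l = (totient (p ^ s) %/ 2)%N)
    (hordq : ordm (q ^ t)%N l = totient (q ^ t))
    (hgcd : gcdn (totient (p ^ s)) (totient (q ^ t)) = 2%N)
    (hgp : primitive_root_mod (p ^ s)%N g)
    (hgq : primitive_root_mod (q ^ t)%N g)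
    (hi : (i < i' <= s - 1)%N) (hj : (j <= t - 1)%N) :
  (quad_residue p q ->
    chi p s q t l i j * chi_star p s q t l g i' j =
      (totient (p ^ (s - i')) %/ 2 * (q - 2) * q ^ (t - j - 1))%N%:R
        *: chi p s q t l i j
      + (totient (p ^ (s - i')) %/ 2 * totient (q ^ (t - j)))%N%:R
        *: \sum_(j.+1 <= m < t.+1) chi p s q t l i m)
  /\
  (quad_nonresidue p q ->
    chi p s q t l i j * chi_star p s q t l g i' j =
      (totient (p ^ (s - i')) %/ 2 * (q - 2) * q ^ (t - j - 1))%N%:R
        *: chi p s q t l i j
      + (totient (p ^ (s - i')) %/ 2 * totient (q ^ (t - j)))%N%:R
        *: (\sum_(j.+1 <= m < t.+1 | ~~ (2 %| m - j)%N) chi_star p s q t l g i m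
            + \sum_(j.+1 <= m < t.+1 | (2 %| m - j)%N) chi p s q t l i m)).
Proof.
have jt : (j < t)%N by lia.
have i's : (i' < s)%N by lia.
have M1 := prime_power_gt1 p s hp hs; have N1 := prime_power_gt1 q t hq ht.
have pq : coprime p q by rewrite prime_coprime // dvdn_prime2 //; apply/eqP.
have coMN : coprime (p ^ s) (q ^ t) by rewrite coprime_pexpl // coprime_pexpr.
have n0 : (0 < p ^ s * q ^ t)%N by rewrite muln_gt0 (ltnW M1) (ltnW N1).
have phi_even := even_totient_prime_power p s hp hs hp_odd.
have phi0 : (0 < totient (p ^ s))%N by rewrite totient_gt0 (ltnW M1).
have phiq0 : (0 < totient (q ^ t))%N by rewrite totient_gt0 (ltnW N1).
have [Lp [LpE oLp]] := ordm_exp _ _ _ hordp (ltac:(by rewrite divn_gt0 // dvdn_leq)).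
have [Lq [LqE oLq]] := ordm_exp _ _ _ hordq phiq0.
have [Gp [GpE oGp]] := ordm_exp _ _ _ hgp phi0.
have [Gq [GqE oGq]] := ordm_exp _ _ _ hgq phiq0.
have {}LpE : val Lp = l%:R by rewrite LpE -pmulrn.
have {}LqE : val Lq = l%:R by rewrite LqE -pmulrn.
have q_unit : (q%:R : 'Z_(p ^ s)) \is a GRing.unit.
  by rewrite unitZpE // coprime_pexpl.
have p_unit : (p%:R : 'Z_(q ^ t)) \is a GRing.unit.
  by rewrite unitZpE // coprime_pexpl // coprime_sym.
pose Q : {unit 'Z_(p ^ s)} := FinRing.unit _ q_unit.
pose P : {unit 'Z_(q ^ t)} := FinRing.unit _ p_unit.
pose H : {group {unit 'Z_(p ^ s)}} := <[Lp]>%G.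
have := qX_exp_eq1 l (p ^ s * q ^ t) n0.
move=> /(chinese_root_split _ _ _ _ coMN)[zeta [eta [zM eN zE]]].
have lpow (m d : nat) (u : {unit 'Z_m}) : val u = l%:R -> #[u]%g = d -> l%:R ^+ d = 1 :> 'Z_m.
  by move=> <- <-; rewrite -FinRing.val_unitX expg_order.
pose PX c := exp_sum (cyclic_ring l (p ^ s * q ^ t)) (p ^ s) zeta (unit_orbit (p ^ s) H c).
pose QY k := exp_sum (cyclic_ring l (p ^ s * q ^ t)) (q ^ t) eta
  (unit_orbit (q ^ t) setT (q%:R ^+ k)).
(* Modulo [p^s] the factor [q^k] is the unit [Q^k], which may change the [H]-orbit; modulo [q^t] the
   unit [p^a] is absorbed. *)
have chiE a k : chi p s q t l a k = PX (p%:R ^+ a * val (Q ^+ k)%g) * QY k.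
  rewrite /chi coset_sum_exp_sum zE.
  rewrite (exp_sum_cyclo_coset_split _ _ _ _ _ _ _ _ _ M1 N1 coMN
    (coprime_half_totient p s _ hp hs hp34 hgcd)
    (lpow _ _ _ LpE oLp) (lpow _ _ _ LqE oLq) zM eN).
  congr (_ * _); last first.
    rewrite (cyclo_coset_primitive _ l Lq (P ^+ a)%g _ (q%:R ^+ k)) //.
    by rewrite FinRing.val_unitX -pmulrn natrM !natrX mulrC.
  rewrite (cyclo_coset_orbit _ _ Lp) //.
  by rewrite FinRing.val_unitX -pmulrn natrM !natrX.
(* [g] leaves a trace only modulo [p^s], as [Gp]. *)
have chi_starE a k : chi_star p s q t l g a k = PX (p%:R ^+ a * val (Q ^+ k * Gp)%g) * QY k.
  rewrite /chi_star coset_sum_exp_sum zE.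
  rewrite (exp_sum_cyclo_coset_split _ _ _ _ _ _ _ _ _ M1 N1 coMN
    (coprime_half_totient p s _ hp hs hp34 hgcd)
    (lpow _ _ _ LpE oLp) (lpow _ _ _ LqE oLq) zM eN).
  congr (_ * _); last first.
    rewrite (cyclo_coset_primitive _ l Lq (P ^+ a * Gq)%g _ (q%:R ^+ k)) //.
    rewrite intrM FinRing.val_unitM FinRing.val_unitX GqE -pmulrn natrM !natrX.
    by rewrite mulrA [_ * q%:R ^+ k]mulrC.
  rewrite (cyclo_coset_orbit _ _ Lp) //.
  by rewrite intrM FinRing.val_unitM FinRing.val_unitX GpE -pmulrn natrM !natrX mulrA.
pose c := p%:R ^+ i * val (Q ^+ j)%g.
have absorb : PX c * PX (p%:R ^+ i' * val (Q ^+ j * Gp)%g)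
    = PX c *+ (totient (p ^ (s - i')) %/ 2).
  rewrite /PX exp_sum_absorb //; last first.
    (* Since [i < i'], at least one factor [p] remains beyond [c], as [unit_orbit_absorb]
       requires. *)
    have -> : p%:R ^+ i' * val (Q ^+ j * Gp)%g
        = c * (p%:R * (p%:R ^+ (i' - i.+1) * val Gp)).
      have -> : i' = (i + (i' - i.+1).+1)%N by lia.
      rewrite exprD exprS /c FinRing.val_unitM.
      have -> : (i + (i' - i.+1).+1 - i.+1 = i' - i.+1)%N by lia.
      ring.
    exact: (unit_orbit_absorb p s hp hs Gp H hp_odd oGp oLp).
  by rewrite card_unit_orbitM (card_unit_orbit p s hp hs Gp H hp_odd oGp oLp).
(* Both cases are instances of this; only the identification of [PX c * QY k] as a [chi] or
   [chi_star] depends on the quadratic character of [q]. *)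
have product (F : nat -> cyclic_ring l (p ^ s * q ^ t)) :
    (forall k, (j < k < t.+1)%N -> F k = PX c * QY k) ->
    chi p s q t l i j * chi_star p s q t l g i' j =
      (totient (p ^ (s - i')) %/ 2 * (q - 2) * q ^ (t - j - 1))%N%:R
        *: chi p s q t l i j
      + (totient (p ^ (s - i')) %/ 2 * totient (q ^ (t - j)))%N%:R
        *: \sum_(j.+1 <= m < t.+1) F m.
  move=> FE; rewrite (eq_big_nat _ _ FE) -mulr_sumr chi_starE !chiE -/c !scaler_nat.
  rewrite mulrACA absorb -expr2 exp_sum_units_sqr // -/(QY j).
  rewrite mulrDr !mulrnAl !mulrnAr -!mulrnA -!/(QY _).
  by congr (_ *+ _ + _ *+ _); rewrite mulnC ?mulnA.
have PX_H (u : {unit 'Z_(p ^ s)}) : u \in H -> PX (p%:R ^+ i * val (Q ^+ j * u)%g) = PX c.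
  by move=> uH; rewrite FinRing.val_unitM mulrA /PX unit_orbitM.
split=> [res|nres].
  (* [Q] lies in [H], so the extra factor [q^(k-j)] keeps the [H]-orbit. *)
  apply: product => k /andP[jk _]; rewrite chiE -(subnKC (ltnW jk)) expgD.
  rewrite PX_H // groupX //.
  exact: (quad_residue_in_index2 p s Gp Lp Q q hp hs hp_odd oGp oLp erefl res).
have QN := quad_nonresidue_notin_index2 p s Gp Lp Q q hp hs hp_odd oGp oLp erefl nres.
have Q2 := index2_sqr p s hp hs Gp H hp_odd oGp oLp Q.
have QG := index2_mul_generator p s hp hs Gp H hp_odd oGp oLp Q QN.
rewrite (product (fun k => if (2 %| k - j)%N then chi p s q t l i k
                          else chi_star p s q t l g i k)).
  congr (_ + _ *: _); rewrite (bigID (fun k => 2 %| k - j)%N) /= addrC.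
  by congr (_ + _); apply: eq_bigr => k; [move=> /negPf ->|move=> ->].
move=> k /andP[jk _].
rewrite chiE chi_starE -(subnKC (ltnW jk)) [(j + (k - j) - j)%N]addKn expgD.
(* For even [k - j], [Q^(k-j)] is a power of [Q^2]; for odd [k - j], [Q^(k-j) Gp] is a power of
   [Q^2] times [Q Gp]. Both lie in [H]. *)
rewrite -mulgA; case: ifPn => [/dvdnP[r ->]|odd_kj].
  by rewrite PX_H // mulnC expgM groupX.
rewrite PX_H // -(odd_double_half (k - j)) -[odd _]negbK -dvdn2 odd_kj.
by rewrite addnC expgD -mulgA groupM // -mul2n expgM groupX.
Qed.
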